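(* Let $0<\varepsilon<\sqrt{2/3}$, and let $f_\varepsilon$, $\tilde f_\varepsilon$, $r_\varepsilon$, $t_\varepsilon$ be as defined in the context. Define $g_\varepsilon:T^2\to B^2$ by $$g_\varepsilon(\theta_1,\theta_2)=\left(r_{1,\varepsilon}(\theta_1,\theta_2)e^{i(2\theta_1+\theta_2)},\ r_{2,\varepsilon}(\theta_1,\theta_2)e^{i(\theta_1+2\theta_2)}\right),$$ where $r_{1,\varepsilon}=\sqrt{r_\varepsilon^2-\frac23\varepsilon\cos\theta_1}$ and $r_{2,\varepsilon}=\sqrt{r_\varepsilon^2+\frac13\varepsilon\cos\theta_1}$. Assume $\varepsilon$ is such that $f_\varepsilon$ and $g_\varepsilon$ are well defined as maps into $B^2$ (the radicands being positive). Then $g_\varepsilon$ is a perturbation of $f_\varepsilon$ having exactly four transverse double points. Moreover, the lift $$\tilde g_\varepsilon(\theta_1,\theta_2)=e^{i(t_\varepsilon(\theta_1,\theta_2)+s_\varepsilon(\theta_1,\theta_2))}\left(r_{1,\varepsilon}e^{i(2\theta_1+\theta_2)},\ r_{2,\varepsilon}e^{i(\theta_1+2\theta_2)},\ \sqrt{1-r_{1,\varepsilon}^2-r_{2,\varepsilon}^2}\right),\qquad s_\varepsilon(\theta_1,\theta_2)=\varepsilon\sin\theta_1,$$ is Legendrian isotopic to $\tilde f_\varepsilon$ in $S^5$.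
   Context: $T^2$ has angular coordinates $(\theta_1,\theta_2)$ modulo $2\pi$, and $B^2$ is the open unit ball in $\mathbb{C}^2$. Set $\delta=\sqrt{\frac13-\frac{\varepsilon^2}2}$ and $r_\varepsilon(\theta_1,\theta_2)=\delta+\varepsilon\sin(\theta_1+\theta_2)$. The map $f_\varepsilon:T^2\to B^2$ is $f_\varepsilon(\theta_1,\theta_2)=(r_\varepsilon e^{i(2\theta_1+\theta_2)},r_\varepsilon e^{i(\theta_1+2\theta_2)})$. Its lift is $\tilde f_\varepsilon=e^{it_\varepsilon}\left(r_\varepsilon e^{i(2\theta_1+\theta_2)},r_\varepsilon e^{i(\theta_1+2\theta_2)},\sqrt{1-2r_\varepsilon^2}\right)\in S^5\subset\mathbb{C}^3$, where $t_\varepsilon(\theta_1,\theta_2)=\int_{f_\varepsilon(\gamma)}\tau$ modulo $2\pi$, with $\tau=-\sum_{i=1}^2(x_i\,dy_i-y_i\,dx_i)$ and $\gamma$ a path in $T^2$ from $(0,0)$ to $(\theta_1,\theta_2)$. The sphere $S^5$ carries the standard contact form, the restriction of $\frac12\sum_{i=1}^3(x_i\,dy_i-y_i\,dx_i)$. ''Perturbation'' means that $g_\varepsilon$ is obtained from $f_\varepsilon$ by changing the two radial functions from $r_\varepsilon$ to $r_{1,\varepsilon},r_{2,\varepsilon}$. A double point is an unordered pair of distinct points of $T^2$ with the same image; it is transverse if the two image tangent planes are transverse in $\mathbb{C}^2$. *)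

(* Defs.v *)
From Stdlib Require Import Reals List.
From Coquelicot Require Import Coquelicot.
Open Scope R_scope.

(* The torus T^2 is R^2 modulo this relation; a map on T^2 is a map on R^2
   satisfying [torus_map], and points of T^2 are compared with [teq]. *)
Definition cong2pi (a b : R) : Prop := exists k : Z, a = b + 2 * PI * IZR k.

Definition teq (p q : R * R) : Prop :=
  cong2pi (fst p) (fst q) /\ cong2pi (snd p) (snd q).

Definition torus_map {A : Type} (h : R * R -> A) : Prop :=
  forall p q, teq p q -> h p = h q.

Definition cis (a : R) : C := (cos a, sin a).

Definition C3 : Type := (C * C * C)%type.
Definition z1 (z : C3) : C := fst (fst z).
Definition z2 (z : C3) : C := snd (fst z).
Definition z3 (z : C3) : C := snd z.

Definition in_B2 (z : C * C) : Prop := Cmod (fst z) ^ 2 + Cmod (snd z) ^ 2 < 1.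

Definition in_S5 (z : C3) : Prop :=
  Cmod (z1 z) ^ 2 + Cmod (z2 z) ^ 2 + Cmod (z3 z) ^ 2 = 1.

(* The value of x dy - y dx at the point z on the tangent vector w. *)
Definition xdy_ydx (z w : C) : R := Re z * Im w - Im z * Re w.

Definition tau (z w : C * C) : R :=
  - (xdy_ydx (fst z) (fst w) + xdy_ydx (snd z) (snd w)).

Definition contact_form (z w : C3) : R :=
  / 2 * (xdy_ydx (z1 z) (z1 w) + xdy_ydx (z2 z) (z2 w) + xdy_ydx (z3 z) (z3 w)).

Section Differential.
Context {V : NormedModule R_AbsRing}.

(* For V = R^n, existence of all directional derivatives, each of class C^k,
   is the usual definition of class C^(k+1) by partial derivatives. *)
Fixpoint class_C (k : nat) (f : V -> R) : Prop :=
  match k with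
  | O => forall x, continuous f x
  | S k' =>
      (forall x, continuous f x) /\
      forall v : V,
        (forall x, ex_derive (fun s : R => f (plus x (scal s v))) 0) /\
        class_C k' (fun x => Derive (fun s : R => f (plus x (scal s v))) 0)
  end.

Definition smooth (f : V -> R) : Prop := forall k, class_C k f.

Definition smoothC (h : V -> C) : Prop :=
  smooth (fun x => Re (h x)) /\ smooth (fun x => Im (h x)).

Definition smoothC3 (h : V -> C3) : Prop :=
  smoothC (fun x => z1 (h x)) /\ smoothC (fun x => z2 (h x)) /\
  smoothC (fun x => z3 (h x)).

(* For differentiable h: the differential of h at x sends v to w. *)
Definition dirder (h : V -> C) (x v : V) (w : C) : Prop :=
  is_derive (fun s : R => Re (h (plus x (scal s v)))) 0 (Re w) /\
  is_derive (fun s : R => Im (h (plus x (scal s v)))) 0 (Im w).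

Definition dirder2 (h : V -> C * C) (x v : V) (w : C * C) : Prop :=
  dirder (fun y => fst (h y)) x v (fst w) /\
  dirder (fun y => snd (h y)) x v (snd w).

Definition dirder3 (h : V -> C3) (x v : V) (w : C3) : Prop :=
  dirder (fun y => z1 (h y)) x v (z1 w) /\
  dirder (fun y => z2 (h y)) x v (z2 w) /\
  dirder (fun y => z3 (h y)) x v (z3 w).

End Differential.

Definition delta (eps : R) : R := sqrt (1 / 3 - eps ^ 2 / 2).

Definition r_ (eps : R) (th : R * R) : R := delta eps + eps * sin (fst th + snd th).

Definition radicand1 (eps : R) (th : R * R) : R :=
  r_ eps th ^ 2 - 2 / 3 * eps * cos (fst th).

Definition radicand2 (eps : R) (th : R * R) : R :=
  r_ eps th ^ 2 + 1 / 3 * eps * cos (fst th).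

Definition r1_ (eps : R) (th : R * R) : R := sqrt (radicand1 eps th).
Definition r2_ (eps : R) (th : R * R) : R := sqrt (radicand2 eps th).

Definition s_ (eps : R) (th : R * R) : R := eps * sin (fst th).

Definition map_of_radii (rho1 rho2 : R * R -> R) (th : R * R) : C * C :=
  (Cmult (RtoC (rho1 th)) (cis (2 * fst th + snd th)),
   Cmult (RtoC (rho2 th)) (cis (fst th + 2 * snd th))).

Definition f_ (eps : R) : R * R -> C * C := map_of_radii (r_ eps) (r_ eps).
Definition g_ (eps : R) : R * R -> C * C := map_of_radii (r1_ eps) (r2_ eps).

(* g is obtained from f by changing both radial functions from r to rho1, rho2. *)
Definition is_perturbation (f : R * R -> C * C) (r : R * R -> R)
    (g : R * R -> C * C) (rho1 rho2 : R * R -> R) : Prop :=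
  torus_map r /\ torus_map rho1 /\ torus_map rho2 /\
  (forall th, f th = map_of_radii r r th) /\
  (forall th, g th = map_of_radii rho1 rho2 th).

(* A path in T^2, given by a lift to R^2, of class C^1 on [0, 1]. *)
Definition torus_path (gam : R -> R * R) (p q : R * R) : Prop :=
  teq (gam 0) p /\ teq (gam 1) q /\
  forall s, 0 <= s <= 1 ->
    ex_derive (fun u => fst (gam u)) s /\ ex_derive (fun u => snd (gam u)) s /\
    continuous (Derive (fun u => fst (gam u))) s /\
    continuous (Derive (fun u => snd (gam u))) s.

Definition velocity (c : R -> C * C) (s : R) : C * C :=
  ((Derive (fun u => Re (fst (c u))) s, Derive (fun u => Im (fst (c u))) s),
   (Derive (fun u => Re (snd (c u))) s, Derive (fun u => Im (snd (c u))) s)).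

Definition integral_tau (c : R -> C * C) : R :=
  RInt (fun s => tau (c s) (velocity c s)) 0 1.

(* t_eps is only defined modulo 2 pi; [is_phase eps t] says that t assigns to
   each point some representative, computed along some path. *)
Definition is_phase (eps : R) (t : R * R -> R) : Prop :=
  forall th, exists gam : R -> R * R,
    torus_path gam (0, 0) th /\
    cong2pi (t th) (integral_tau (fun s => f_ eps (gam s))).

Definition Cscal3 (a : C) (z : C3) : C3 :=
  (Cmult a (z1 z), Cmult a (z2 z), Cmult a (z3 z)).

Definition f_lift (eps : R) (t : R * R -> R) (th : R * R) : C3 :=
  Cscal3 (cis (t th))
    (fst (f_ eps th), snd (f_ eps th), RtoC (sqrt (1 - 2 * r_ eps th ^ 2))).

Definition g_lift (eps : R) (t : R * R -> R) (th : R * R) : C3 :=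
  Cscal3 (cis (t th + s_ eps th))
    (fst (g_ eps th), snd (g_ eps th),
     RtoC (sqrt (1 - r1_ eps th ^ 2 - r2_ eps th ^ 2))).

Definition double_point (g : R * R -> C * C) (a : (R * R) * (R * R)) : Prop :=
  ~ teq (fst a) (snd a) /\ g (fst a) = g (snd a).

(* Equality of unordered pairs of points of T^2. *)
Definition same_pair (a b : (R * R) * (R * R)) : Prop :=
  (teq (fst a) (fst b) /\ teq (snd a) (snd b)) \/
  (teq (fst a) (snd b) /\ teq (snd a) (fst b)).

Definition tangent (g : R * R -> C * C) (p : R * R) (w : C * C) : Prop :=
  exists v : R * R, dirder2 g p v w.

Definition transverse_at (g : R * R -> C * C) (a : (R * R) * (R * R)) : Prop :=
  forall w : C * C, exists w1 w2 : C * C,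
    tangent g (fst a) w1 /\ tangent g (snd a) w2 /\
    w = (Cplus (fst w1) (fst w2), Cplus (snd w1) (snd w2)).

(* n double points in all, and every one of them is transverse. *)
Definition has_exactly_transverse_double_points (g : R * R -> C * C) (n : nat) : Prop :=
  (exists l : list ((R * R) * (R * R)),
     length l = n /\
     (forall a, In a l -> double_point g a) /\
     ForallOrdPairs (fun a b => ~ same_pair a b) l /\
     (forall a, double_point g a -> exists b, In b l /\ same_pair a b)) /\
  (forall a, double_point g a -> transverse_at g a).

(* Since T^2 is compact, embeddings are exactly the injective immersions. *)
Definition legendrian_embedding (h : R * R -> C3) : Prop :=
  torus_map h /\
  (forall p, in_S5 (h p)) /\
  smoothC3 h /\
  (forall p q, h p = h q -> teq p q) /\
  (forall p v, dirder3 h p v (RtoC 0, RtoC 0, RtoC 0) -> v = (0, 0)) /\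
  (forall p v w, dirder3 h p v w -> contact_form (h p) w = 0).

(* Smoothness on [0, 1] x T^2 is smoothness of an extension to R x R^2. *)
Definition legendrian_isotopic (h0 h1 : R * R -> C3) : Prop :=
  exists F : R * (R * R) -> C3,
    smoothC3 F /\
    (forall sig, 0 <= sig <= 1 -> legendrian_embedding (fun p => F (sig, p))) /\
    (forall p, F (0, p) = h0 p) /\
    (forall p, F (1, p) = h1 p).

(* Main.v *)
Require Import Defs.
From Stdlib Require Import Reals List.
From Coquelicot Require Import Coquelicot.
From Stdlib Require Import Lra Lia ZArith FunctionalExtensionality.
Open Scope R_scope.

(** Write phi = theta_1 + theta_2. Evaluating the positivity and ball conditions at
    well-chosen points gives eps < delta and 12 delta eps < 1 - 3 eps^2; in
    particular r is positive ([eps_lt_delta], [eps_delta_bound]).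

    Phase. Pulling back tau by f gives - 3 r^2 d phi, and r^2 has mean 1/3, so the
    phase t of the lift is, modulo 2 pi, the explicit function [phase] of phi,
    equal to - phi plus a periodic term ([is_phase_unique]).

    Isotopy. Moving the squared radii linearly in lam from r^2 to those of g, and
    adding lam eps sin theta_1 to the phase, keeps the lift Legendrian
    ([lift_family_contact]). A point of the lift determines the angles
    2 theta_1 + theta_2 and theta_1 + 2 theta_2 and its phase. The two angles
    determine the point of the torus up to a translation by a multiple of
    (2 pi / 3, 2 pi / 3), which changes phi by a multiple of 4 pi / 3; the remaining
    terms of the phase oscillate too little to compensate this, so every stage of
    the isotopy is injective ([lift_family_injective]). The double curves of f are
    thus separated by the phase throughout.

    Double points. If g takes the same value at two points, these differ by such a
    translation and agree in cos theta_1 and in sin phi ([g_eq_iff]); for a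
    nontrivial translation this fixes theta_1 and phi modulo pi, which leaves four
    unordered pairs ([double_point_crossing]). At such a pair the differentials
    of cos theta_1 and of sin phi are different at the two points, which gives
    transversality ([double_point_transverse]). *)

(** * Functions of class C^k *)

Section SmoothFunctions.
Context {V : NormedModule R_AbsRing}.
Implicit Types (f g : V -> R) (x v : V).

Lemma line_at_0 x v : plus x (scal (0 : R) v) = x.
Proof.
  change (0 : R) with (@zero R_AbelianMonoid).
  now rewrite (@scal_zero_l R_Ring), plus_zero_r.
Qed.

Lemma class_C_continuous k f : class_C k f -> forall x, continuous f x.
Proof. destruct k; [easy | now intros []]. Qed.

Lemma class_C_pred k f : class_C (S k) f -> class_C k f.
Proof.
  revert f; induction k as [|k IH]; intros f [fc fd]; [exact fc|].
  split; [exact fc|]; intros v; destruct (fd v) as [fd1 fd2].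
  split; [exact fd1 | now apply IH].
Qed.

(** Together with [class_C_S_elim], this replaces the total operator [Derive] by
    named partial derivatives, so that the rules of calculus can be proved by
    induction on k from explicit formulas. *)
Lemma class_C_S_intro k f (Df : V -> V -> R) :
  (forall x, continuous f x) ->
  (forall v x, is_derive (fun s : R => f (plus x (scal s v))) 0 (Df v x)) ->
  (forall v, class_C k (Df v)) -> class_C (S k) f.
Proof.
  intros fc fd Dfk; split; [exact fc|]; intros v; split.
  - intros x; now exists (Df v x).
  - replace (fun x => _) with (Df v); [apply Dfk|].
    apply functional_extensionality; intros x.
    symmetry; apply is_derive_unique, fd.
Qed.

Lemma class_C_S_elim k f : class_C (S k) f ->
  exists Df : V -> V -> R,
  (forall v x, is_derive (fun s : R => f (plus x (scal s v))) 0 (Df v x)) /\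
  (forall v, class_C k (Df v)).
Proof.
  intros [_ fd].
  exists (fun v x => Derive (fun s : R => f (plus x (scal s v))) 0); split.
  - intros v x; apply Derive_correct, fd.
  - intros v; apply fd.
Qed.

Lemma class_C_const k (c : R) : class_C k (fun _ : V => c).
Proof.
  revert c; induction k as [|k IH]; intros c; [intros x; apply continuous_const|].
  apply class_C_S_intro with (Df := fun _ _ => 0); auto.
  - intros x; apply continuous_const.
  - intros v x; apply (@is_derive_const R_AbsRing R_NormedModule).
Qed.

Lemma class_C_linear k f :
  (forall x, continuous f x) ->
  (forall x v (s : R), f (plus x (scal s v)) = f x + s * f v) -> class_C k f.
Proof.
  intros fc fl; destruct k as [|k]; [exact fc|].
  apply class_C_S_intro with (Df := fun v _ => f v); auto using class_C_const.
  intros v x.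
  apply (is_derive_ext (fun s => f x + s * f v)); [now intros s; rewrite fl|].
  auto_derive; [easy | ring].
Qed.

Lemma class_C_plus k f g :
  class_C k f -> class_C k g -> class_C k (fun x => f x + g x).
Proof.
  revert f g; induction k as [|k IH]; intros f g Hf Hg.
  - intros x; apply (continuous_plus f g); auto.
  - destruct (class_C_S_elim _ _ Hf) as (Df & fd & fk).
    destruct (class_C_S_elim _ _ Hg) as (Dg & gd & gk).
    apply class_C_S_intro with (Df := fun v x => Df v x + Dg v x); auto.
    + intros x; apply (continuous_plus f g); eapply class_C_continuous; eauto.
    + intros v x; apply (is_derive_plus (V := R_NormedModule)); auto.
Qed.

Lemma class_C_mult k f g :
  class_C k f -> class_C k g -> class_C k (fun x => f x * g x).
Proof.
  revert f g; induction k as [|k IH]; intros f g Hf Hg.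
  - intros x; apply (continuous_mult f g); auto.
  - destruct (class_C_S_elim _ _ Hf) as (Df & fd & fk).
    destruct (class_C_S_elim _ _ Hg) as (Dg & gd & gk).
    apply class_C_S_intro with (Df := fun v x => Df v x * g x + f x * Dg v x).
    + intros x; apply (continuous_mult f g); eapply class_C_continuous; eauto.
    + intros v x.
      pose proof (is_derive_mult _ _ 0 _ _ (fd v x) (gd v x) Rmult_comm) as D.
      cbv beta in D; rewrite line_at_0 in D; exact D.
    + intros v; apply class_C_plus; apply IH; auto using class_C_pred.
Qed.

Lemma is_derive_line_comp (h : R -> R) f x v (df dh : R) :
  is_derive (fun s : R => f (plus x (scal s v))) 0 df ->
  is_derive h (f x) dh ->
  is_derive (fun s : R => h (f (plus x (scal s v)))) 0 (df * dh).
Proof.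
  intros fd hd; apply (is_derive_comp h); [now rewrite line_at_0 | exact fd].
Qed.

(** Sine and cosine are treated together because each is the derivative of the
    other up to sign. *)
Lemma class_C_sin_cos k f : class_C k f ->
  class_C k (fun x => sin (f x)) /\ class_C k (fun x => cos (f x)).
Proof.
  assert (C0 : (forall x, continuous f x) ->
     (forall x, continuous (fun y => sin (f y)) x) /\
     (forall x, continuous (fun y => cos (f y)) x)).
  { intros fc; split; intros x; apply (continuous_comp f); auto;
      [apply continuous_sin | apply continuous_cos]. }
  induction k as [|k IH]; intros Hf; [now apply C0|].
  destruct (class_C_S_elim _ _ Hf) as (Df & fd & fk).
  destruct (IH (class_C_pred _ _ Hf)) as [sk ck].
  destruct (C0 (class_C_continuous _ _ Hf)) as [sc cc].
  split.
  - apply class_C_S_intro with (Df := fun v x => Df v x * cos (f x)); auto.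
    + intros v x; apply is_derive_line_comp; auto using is_derive_sin.
    + intros v; now apply class_C_mult.
  - apply class_C_S_intro with (Df := fun v x => Df v x * (-1 * sin (f x))); auto.
    + intros v x; apply is_derive_line_comp; auto.
      replace (-1 * sin (f x)) with (- sin (f x)) by ring; apply is_derive_cos.
    + intros v; apply class_C_mult; auto.
      apply class_C_mult; auto using class_C_const.
Qed.

(** The derivative - f' / f^2 involves 1 / f again, one order lower, which is what
    makes the induction close; likewise f' / (2 sqrt f) in [class_C_sqrt]. *)
Lemma class_C_inv k f :
  (forall x, f x <> 0) -> class_C k f -> class_C k (fun x => / f x).
Proof.
  intros f0.
  assert (C0 : (forall x, continuous f x) -> forall x, continuous (fun y => / f y) x).
  { intros fc x; apply (continuous_comp f Rinv); auto.
    now apply continuous_Rinv. }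
  induction k as [|k IH]; intros Hf; [exact (C0 Hf)|].
  destruct (class_C_S_elim _ _ Hf) as (Df & fd & fk).
  pose proof (IH (class_C_pred _ _ Hf)) as ik.
  apply class_C_S_intro with (Df := fun v x => Df v x * (-1 * (/ f x * / f x))).
  - exact (C0 (class_C_continuous _ _ Hf)).
  - intros v x; apply is_derive_line_comp; auto.
    auto_derive; [apply f0 | now field].
  - intros v; apply class_C_mult; auto.
    apply class_C_mult; auto using class_C_const, class_C_mult.
Qed.

Lemma class_C_sqrt k f :
  (forall x, 0 < f x) -> class_C k f -> class_C k (fun x => sqrt (f x)).
Proof.
  intros f0.
  assert (C0 : (forall x, continuous f x) -> forall x, continuous (fun y => sqrt (f y)) x).
  { intros fc x; apply (continuous_comp f sqrt); auto using continuous_sqrt. }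
  induction k as [|k IH]; intros Hf; [exact (C0 Hf)|].
  destruct (class_C_S_elim _ _ Hf) as (Df & fd & fk).
  pose proof (IH (class_C_pred _ _ Hf)) as qk.
  apply class_C_S_intro with (Df := fun v x => Df v x * (/ 2 * / sqrt (f x))).
  - exact (C0 (class_C_continuous _ _ Hf)).
  - intros v x; apply is_derive_line_comp; auto.
    pose proof (sqrt_lt_R0 _ (f0 x)).
    auto_derive; [apply f0 | field; lra].
  - intros v; apply class_C_mult; auto.
    apply class_C_mult; auto using class_C_const.
    apply class_C_inv; auto.
    intros x; pose proof (sqrt_lt_R0 _ (f0 x)); lra.
Qed.

Lemma smooth_const (c : R) : smooth (fun _ : V => c).
Proof. intros k; apply class_C_const. Qed.

Lemma smooth_plus f g : smooth f -> smooth g -> smooth (fun x => f x + g x).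
Proof. intros Hf Hg k; now apply class_C_plus. Qed.

Lemma smooth_mult f g : smooth f -> smooth g -> smooth (fun x => f x * g x).
Proof. intros Hf Hg k; now apply class_C_mult. Qed.

Lemma smooth_opp f : smooth f -> smooth (fun x => - f x).
Proof.
  intros Hf; replace (fun x => - f x) with (fun x => -1 * f x).
  - apply smooth_mult; auto using smooth_const.
  - apply functional_extensionality; intros x; ring.
Qed.

Lemma smooth_minus f g : smooth f -> smooth g -> smooth (fun x => f x - g x).
Proof. intros; apply smooth_plus; auto using smooth_opp. Qed.

Lemma smooth_sin f : smooth f -> smooth (fun x => sin (f x)).
Proof. intros Hf k; now apply class_C_sin_cos. Qed.

Lemma smooth_cos f : smooth f -> smooth (fun x => cos (f x)).
Proof. intros Hf k; now apply class_C_sin_cos. Qed.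

Lemma smooth_sqrt f :
  (forall x, 0 < f x) -> smooth f -> smooth (fun x => sqrt (f x)).
Proof. intros f0 Hf k; now apply class_C_sqrt. Qed.

Lemma smooth_linear f :
  (forall x, continuous f x) ->
  (forall x v (s : R), f (plus x (scal s v)) = f x + s * f v) -> smooth f.
Proof. intros fc fl k; now apply class_C_linear. Qed.

Lemma smooth_ex_derive f : smooth f ->
  forall x v, ex_derive (fun s : R => f (plus x (scal s v))) 0.
Proof. intros Hf x v; apply (Hf 1%nat). Qed.

End SmoothFunctions.

Ltac smooth_tac :=
  repeat first [assumption | apply smooth_const | apply smooth_minus | apply smooth_plus
    | apply smooth_opp | apply smooth_mult | apply smooth_sin | apply smooth_cos].

Lemma smooth_fst_RR : smooth (fun th : R * R => fst th).
Proof. apply smooth_linear; [intros x; apply continuous_fst | reflexivity]. Qed.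

Lemma smooth_snd_RR : smooth (fun th : R * R => snd th).
Proof. apply smooth_linear; [intros x; apply continuous_snd | reflexivity]. Qed.

Lemma is_derive_line_fst (th v : R * R) :
  is_derive (fun s : R => fst (plus th (scal s v))) 0 (fst v).
Proof.
  apply (is_derive_ext (fun s => fst th + s * fst v)); [reflexivity|].
  auto_derive; [easy | ring].
Qed.

Lemma is_derive_line_snd (th v : R * R) :
  is_derive (fun s : R => snd (plus th (scal s v))) 0 (snd v).
Proof.
  apply (is_derive_ext (fun s => snd th + s * snd v)); [reflexivity|].
  auto_derive; [easy | ring].
Qed.

(** * Angles modulo 2 pi *)

Lemma cos_sin_2PI_Z k : cos (2 * PI * IZR k) = 1 /\ sin (2 * PI * IZR k) = 0.
Proof.
  assert (S : sin (IZR k * PI) = 0) by (apply sin_eq_0_1; now exists k).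
  replace (2 * PI * IZR k) with (2 * (IZR k * PI)) by ring.
  rewrite cos_2a_sin, sin_2a, S; split; ring.
Qed.

Lemma cong2pi_cos_sin a b : cong2pi a b <-> cos a = cos b /\ sin a = sin b.
Proof.
  split.
  - intros [k ->]; destruct (cos_sin_2PI_Z k) as [ck sk].
    rewrite cos_plus, sin_plus, ck, sk; split; ring.
  - intros [ec es].
    (* cos (a - b) = 1, that is, sin ((a - b) / 2) = 0. *)
    assert (C1 : cos (2 * ((a - b) / 2)) = 1).
    { replace (2 * ((a - b) / 2)) with (a - b) by field.
      rewrite cos_minus, ec, es; pose proof (sin2_cos2 b); unfold Rsqr in *; lra. }
    rewrite cos_2a_sin in C1.
    destruct (sin_eq_0_0 ((a - b) / 2)) as [k Hk]; [nra|].
    exists k; lra.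
Qed.

Lemma cong2pi_refl a : cong2pi a a.
Proof. exists 0%Z; ring. Qed.

Lemma cong2pi_trans a b c : cong2pi a b -> cong2pi b c -> cong2pi a c.
Proof. intros [k ->] [l ->]; exists (l + k)%Z; rewrite plus_IZR; ring. Qed.

Lemma cong2pi_plus a b a' b' : cong2pi a a' -> cong2pi b b' -> cong2pi (a + b) (a' + b').
Proof. intros [k ->] [l ->]; exists (k + l)%Z; rewrite plus_IZR; ring. Qed.

Lemma cong2pi_plus_cancel a b a' b' :
  cong2pi (a + b) (a' + b') -> cong2pi b b' -> cong2pi a a'.
Proof. intros [k Hk] [l ->]; exists (k - l)%Z; rewrite minus_IZR; lra. Qed.

Lemma cong2pi_lin (m n : Z) a b a' b' : cong2pi a a' -> cong2pi b b' ->
  cong2pi (IZR m * a + IZR n * b) (IZR m * a' + IZR n * b').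
Proof.
  intros [k ->] [l ->]; exists (m * k + n * l)%Z.
  rewrite plus_IZR, !mult_IZR; ring.
Qed.

Lemma teq_trans p q r : teq p q -> teq q r -> teq p r.
Proof. intros [H1 H2] [H3 H4]; split; eapply cong2pi_trans; eauto. Qed.

Lemma teq_lin (m n : Z) p q : teq p q ->
  cong2pi (IZR m * fst p + IZR n * snd p) (IZR m * fst q + IZR n * snd q).
Proof. intros [H1 H2]; now apply cong2pi_lin. Qed.

Lemma teq_fst p q : teq p q ->
  cos (fst p) = cos (fst q) /\ sin (fst p) = sin (fst q).
Proof. intros [H _]; now apply cong2pi_cos_sin. Qed.

Lemma teq_sum p q : teq p q -> cong2pi (fst p + snd p) (fst q + snd q).
Proof. intros H; apply (teq_lin 1 1) in H; now rewrite !Rmult_1_l in H. Qed.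

Lemma teq_sum_cos_sin p q : teq p q ->
  cos (fst p + snd p) = cos (fst q + snd q) /\
  sin (fst p + snd p) = sin (fst q + snd q).
Proof. intros H; now apply cong2pi_cos_sin, teq_sum. Qed.

Lemma teq_arg1 p q : teq p q -> cong2pi (2 * fst p + snd p) (2 * fst q + snd q).
Proof. intros H; apply (teq_lin 2 1) in H; now rewrite !Rmult_1_l in H. Qed.

Lemma teq_arg2 p q : teq p q -> cong2pi (fst p + 2 * snd p) (fst q + 2 * snd q).
Proof. intros H; apply (teq_lin 1 2) in H; now rewrite !Rmult_1_l in H. Qed.

(** The angles 2 u + v and u + 2 v define a threefold covering of the torus by
    itself, whose deck group is generated by the translation by
    (2 pi / 3, 2 pi / 3). *)
Lemma covering_fibre p q :
  cong2pi (2 * fst p + snd p) (2 * fst q + snd q) ->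
  cong2pi (fst p + 2 * snd p) (fst q + 2 * snd q) ->
  exists N c : Z, fst p = fst q + 2 * PI / 3 * IZR N /\
                  snd p = snd q + 2 * PI / 3 * IZR N + 2 * PI * IZR c.
Proof.
  intros [m Hm] [n Hn]; exists (2 * m - n)%Z, (n - m)%Z.
  rewrite !minus_IZR, mult_IZR; lra.
Qed.

(** * Polar coordinates *)

Definition polar (rho a : R) : C := Cmult (RtoC rho) (cis a).

Lemma polar_eq rho a : polar rho a = (rho * cos a, rho * sin a).
Proof. unfold polar, cis, RtoC, Cmult; simpl; f_equal; ring. Qed.

Lemma cis_mult a b : Cmult (cis a) (cis b) = cis (a + b).
Proof.
  unfold cis, Cmult; simpl; rewrite cos_plus, sin_plus; f_equal; ring.
Qed.

Lemma cis_polar a rho b : Cmult (cis a) (polar rho b) = polar rho (b + a).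
Proof.
  unfold polar; rewrite <- cis_mult.
  rewrite Cmult_assoc, (Cmult_comm (cis a)), <- Cmult_assoc; f_equal; apply Cmult_comm.
Qed.

Lemma cis_cong2pi a b : cong2pi a b -> cis a = cis b.
Proof. intros H; apply cong2pi_cos_sin in H; unfold cis; now f_equal. Qed.

Lemma polar_cong2pi rho a b : cong2pi a b -> polar rho a = polar rho b.
Proof. intros H; unfold polar; now rewrite (cis_cong2pi a b). Qed.

Lemma Cmod_polar rho a : Cmod (polar rho a) ^ 2 = rho ^ 2.
Proof.
  rewrite polar_eq; unfold Cmod; rewrite pow2_sqrt; simpl fst; simpl snd.
  - pose proof (sin2_cos2 a); unfold Rsqr in *; nra.
  - nra.
Qed.

Lemma polar_inj rho a rho' a' : 0 < rho -> 0 < rho' ->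
  polar rho a = polar rho' a' -> rho = rho' /\ cong2pi a a'.
Proof.
  intros h h' E.
  assert (E2 : rho = rho').
  { apply (f_equal (fun z => Cmod z ^ 2)) in E; rewrite !Cmod_polar in E; nra. }
  split; [exact E2|]; subst rho'.
  rewrite !polar_eq in E; injection E as E1 E2.
  apply cong2pi_cos_sin; split; eapply Rmult_eq_reg_l; eauto; lra.
Qed.

(** The velocity of rho e^(ia), when rho and a have velocities dr and da. *)
Definition polar_velocity (rho a dr da : R) : C := Cmult (dr, rho * da) (cis a).

Lemma is_derive_polar (rho a : R -> R) (s dr da : R) :
  is_derive rho s dr -> is_derive a s da ->
  is_derive (fun u => Re (polar (rho u) (a u))) s
    (Re (polar_velocity (rho s) (a s) dr da)) /\
  is_derive (fun u => Im (polar (rho u) (a u))) s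
    (Im (polar_velocity (rho s) (a s) dr da)).
Proof.
  intros Hr Ha; unfold Re, Im, polar_velocity, polar, cis, RtoC, Cmult; simpl.
  split; (auto_derive;
    [repeat split; auto; eexists; eauto
    | change (fun x => rho x) with rho; change (fun x => a x) with a;
      rewrite (is_derive_unique _ _ _ Hr), (is_derive_unique _ _ _ Ha); ring]).
Qed.

Lemma xdy_ydx_polar rho a dr da :
  xdy_ydx (polar rho a) (polar_velocity rho a dr da) = rho ^ 2 * da.
Proof.
  unfold xdy_ydx, Re, Im, polar_velocity, polar, cis, RtoC, Cmult; simpl.
  transitivity (rho ^ 2 * da * (Rsqr (sin a) + Rsqr (cos a)));
    [unfold Rsqr; ring | rewrite sin2_cos2; ring].
Qed.

(** The pullback of tau along a curve depends only on the radii and on the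
    velocities of the angles. *)
Lemma tau_polar_curve (rho1 a1 rho2 a2 : R -> R) (s dr1 da1 dr2 da2 : R) :
  is_derive rho1 s dr1 -> is_derive a1 s da1 ->
  is_derive rho2 s dr2 -> is_derive a2 s da2 ->
  let c := fun u => (polar (rho1 u) (a1 u), polar (rho2 u) (a2 u)) in
  tau (c s) (velocity c s) = - (rho1 s ^ 2 * da1 + rho2 s ^ 2 * da2).
Proof.
  intros Hr1 Ha1 Hr2 Ha2 c.
  assert (E : velocity c s =
    (polar_velocity (rho1 s) (a1 s) dr1 da1, polar_velocity (rho2 s) (a2 s) dr2 da2)).
  { destruct (is_derive_polar _ _ _ _ _ Hr1 Ha1) as [R1 I1].
    destruct (is_derive_polar _ _ _ _ _ Hr2 Ha2) as [R2 I2].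
    apply injective_projections; apply injective_projections;
      apply is_derive_unique; assumption. }
  rewrite E; unfold tau, c; simpl fst; simpl snd; now rewrite !xdy_ydx_polar.
Qed.

Section PolarDifferential.
Context {V : NormedModule R_AbsRing}.

Lemma dirder_polar (rho a : V -> R) (x v : V) (dr da : R) :
  is_derive (fun s : R => rho (plus x (scal s v))) 0 dr ->
  is_derive (fun s : R => a (plus x (scal s v))) 0 da ->
  dirder (fun y => polar (rho y) (a y)) x v (polar_velocity (rho x) (a x) dr da).
Proof.
  intros Hr Ha.
  pose proof (is_derive_polar _ _ _ _ _ Hr Ha) as H.
  cbv beta in H; now rewrite line_at_0 in H.
Qed.

Lemma dirder_unique (h : V -> C) (x v : V) (w w' : C) :
  dirder h x v w -> dirder h x v w' -> w = w'.
Proof.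
  intros [H1 H2] [H1' H2']; apply injective_projections.
  - change (Re w = Re w'); apply is_derive_unique in H1, H1'; congruence.
  - change (Im w = Im w'); apply is_derive_unique in H2, H2'; congruence.
Qed.

(** On any tangent vector, x dy - y dx reads rho^2 times the variation of the
    angle; the radius only has to be differentiable. *)
Lemma xdy_ydx_dirder_polar (rho a : V -> R) (x v : V) (w : C) (da : R) :
  smooth rho ->
  is_derive (fun s : R => a (plus x (scal s v))) 0 da ->
  dirder (fun y => polar (rho y) (a y)) x v w ->
  xdy_ydx (polar (rho x) (a x)) w = rho x ^ 2 * da.
Proof.
  intros Hr Ha Hw.
  destruct (smooth_ex_derive _ Hr x v) as [dr Hdr].
  rewrite (dirder_unique _ _ _ _ _ Hw (dirder_polar _ _ _ _ _ _ Hdr Ha)).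
  apply xdy_ydx_polar.
Qed.

Lemma smoothC_polar (rho a : V -> R) :
  smooth rho -> smooth a -> smoothC (fun x => polar (rho x) (a x)).
Proof.
  intros Hr Ha; split; unfold polar, cis, RtoC, Cmult, Re, Im; simpl.
  - apply smooth_minus; apply smooth_mult;
      auto using smooth_const, smooth_sin, smooth_cos.
  - apply smooth_plus; apply smooth_mult;
      auto using smooth_const, smooth_sin, smooth_cos.
Qed.

End PolarDifferential.

(** * The radial function and the phase *)

Lemma delta_sqr eps : 0 < eps -> eps < sqrt (2 / 3) ->
  0 < delta eps /\ delta eps ^ 2 = 1 / 3 - eps ^ 2 / 2.
Proof.
  intros e0 e1.
  assert (E : 0 < 1 / 3 - eps ^ 2 / 2).
  { assert (Q : sqrt (2 / 3) ^ 2 = 2 / 3) by (apply pow2_sqrt; lra).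
    set (q := sqrt (2 / 3)) in *; assert (eps * eps < q * q) by nra; lra. }
  unfold delta; split; [now apply sqrt_lt_R0 | rewrite pow2_sqrt; lra].
Qed.

(** If eps were at least delta, r would vanish somewhere, and there radicand1
    would be negative where cos (theta_1) = 1. *)
Lemma eps_lt_delta eps : 0 < eps -> 0 < delta eps ->
  (forall th, 0 < radicand1 eps th) -> eps < delta eps.
Proof.
  intros e0 d0 H; destruct (Rlt_or_le eps (delta eps)) as [|L]; [easy|].
  specialize (H (0, asin (- (delta eps / eps)))).
  unfold radicand1, r_ in H; simpl fst in H; simpl snd in H.
  rewrite Rplus_0_l, cos_0, sin_asin in H.
  - replace (delta eps + eps * - (delta eps / eps)) with 0 in H by (field; lra); lra.
  - assert (delta eps / eps <= 1) by (now apply Rcomplements.Rle_div_l; [|rewrite Rmult_1_l]).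
    assert (0 < delta eps / eps) by (now apply Rdiv_lt_0_compat); lra.
Qed.

Lemma r_pos eps th : 0 < eps -> eps < delta eps -> 0 < r_ eps th.
Proof. intros e0 L; unfold r_; pose proof (SIN_bound (fst th + snd th)); nra. Qed.

Lemma f_polar eps th : f_ eps th =
  (polar (r_ eps th) (2 * fst th + snd th), polar (r_ eps th) (fst th + 2 * snd th)).
Proof. reflexivity. Qed.

Lemma g_polar eps th : g_ eps th =
  (polar (r1_ eps th) (2 * fst th + snd th), polar (r2_ eps th) (fst th + 2 * snd th)).
Proof. reflexivity. Qed.

(** This is 2 r^2 < 1 at the maximum delta + eps of r, rewritten with
    delta^2 = 1/3 - eps^2/2. *)
Lemma eps_delta_bound eps : delta eps ^ 2 = 1 / 3 - eps ^ 2 / 2 ->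
  (forall th, in_B2 (f_ eps th)) -> 12 * delta eps * eps < 1 - 3 * eps ^ 2.
Proof.
  intros d2 H; specialize (H (PI / 2, 0)).
  unfold in_B2 in H; rewrite f_polar in H; simpl fst in H; simpl snd in H.
  rewrite !Cmod_polar in H; unfold r_ in H; simpl fst in H; simpl snd in H.
  rewrite Rplus_0_r, sin_PI2 in H; nra.
Qed.

(** A primitive of -3 r^2 d(theta_1 + theta_2), the pullback of tau by f_eps. *)
Definition phase (eps : R) (th : R * R) : R :=
  let phi := fst th + snd th in
  - (phi + 6 * delta eps * eps * (1 - cos phi) - 3 / 2 * eps ^ 2 * (sin phi * cos phi)).

Lemma is_derive_phase eps (c1 c2 : R -> R) (s d1 d2 : R) :
  delta eps ^ 2 = 1 / 3 - eps ^ 2 / 2 ->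
  is_derive c1 s d1 -> is_derive c2 s d2 ->
  is_derive (fun u => phase eps (c1 u, c2 u)) s
    (- (3 * r_ eps (c1 s, c2 s) ^ 2 * (d1 + d2))).
Proof.
  intros dd H1 H2; unfold phase, r_; simpl fst; simpl snd; auto_derive.
  - repeat split; eexists; eauto.
  - change (fun x => c1 x) with c1; change (fun x => c2 x) with c2.
    rewrite (is_derive_unique _ _ _ H1), (is_derive_unique _ _ _ H2).
    pose proof (sin2_cos2 (c1 s + c2 s)) as SC; unfold Rsqr in SC.
    set (S := sin (c1 s + c2 s)) in *; set (K := cos (c1 s + c2 s)) in *.
    assert (KK : K * K = 1 - S * S) by lra.
    transitivity (- ((d1 + d2) * (1 + 6 * delta eps * eps * S
       - 3 / 2 * eps ^ 2 * (K * K - S * S)))); [field|].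
    rewrite KK.
    transitivity (- (3 * (delta eps ^ 2 + 2 * delta eps * eps * S + eps ^ 2 * (S * S))
       * (d1 + d2))); [rewrite dd; field | ring].
Qed.

Lemma phase_cong2pi eps p q : teq p q -> cong2pi (phase eps p) (phase eps q).
Proof.
  intros H; destruct (teq_sum_cos_sin _ _ H) as [ec es].
  destruct (teq_sum _ _ H) as [k Hk].
  unfold phase; cbv zeta; rewrite ec, es, Hk.
  exists (- k)%Z; rewrite opp_IZR; ring.
Qed.

(** The fundamental theorem of calculus along gam: the angles 2 u + v and u + 2 v
    of f both have radius r, so the integrand is - r^2 (3 u' + 3 v'), the
    derivative of [phase] along gam. *)
Lemma integral_tau_f eps (gam : R -> R * R) p q :
  delta eps ^ 2 = 1 / 3 - eps ^ 2 / 2 -> torus_path gam p q ->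
  integral_tau (fun s => f_ eps (gam s)) = phase eps (gam 1) - phase eps (gam 0).
Proof.
  intros dd (_ & _ & Hg).
  assert (D : forall s, 0 <= s <= 1 ->
    is_derive (fun u => fst (gam u)) s (Derive (fun u => fst (gam u)) s) /\
    is_derive (fun u => snd (gam u)) s (Derive (fun u => snd (gam u)) s)).
  { intros s Hs; split; apply Derive_correct; now apply Hg. }
  set (d1 := Derive (fun u => fst (gam u))) in *.
  set (d2 := Derive (fun u => snd (gam u))) in *.
  assert (DR : forall s, 0 <= s <= 1 -> is_derive (fun u => r_ eps (gam u)) s
     (eps * cos (fst (gam s) + snd (gam s)) * (d1 s + d2 s))).
  { intros s Hs; destruct (D s Hs) as [D1 D2]; unfold r_.
    pose proof (is_derive_plus (V := R_NormedModule) _ _ _ _ _ D1 D2) as Dp.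
    pose proof (is_derive_comp sin _ _ _ _ (is_derive_sin _) Dp) as Ds.
    pose proof (is_derive_scal _ _ eps _ Ds) as De.
    pose proof (is_derive_plus (V := R_NormedModule) _ _ _ _ _
      (is_derive_const (V := R_NormedModule) (delta eps) s) De) as Dt.
    match type of Dt with is_derive _ _ ?l =>
      replace (eps * cos (fst (gam s) + snd (gam s)) * (d1 s + d2 s)) with l end;
      [exact Dt|].
    unfold plus, scal, zero; simpl; unfold mult; simpl; ring. }
  apply is_RInt_unique.
  apply (is_RInt_ext (fun s => - (3 * r_ eps (gam s) ^ 2 * (d1 s + d2 s)))).
  - rewrite Rmin_left, Rmax_right by lra; intros s Hs.
    assert (Hs' : 0 <= s <= 1) by lra; destruct (D s Hs') as [D1 D2].
    assert (A1 : is_derive (fun u => 2 * fst (gam u) + snd (gam u)) s (2 * d1 s + d2 s)).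
    { apply (is_derive_plus (V := R_NormedModule)); [now apply is_derive_scal | easy]. }
    assert (A2 : is_derive (fun u => fst (gam u) + 2 * snd (gam u)) s (d1 s + 2 * d2 s)).
    { apply (is_derive_plus (V := R_NormedModule)); [easy | now apply is_derive_scal]. }
    pose proof (tau_polar_curve _ _ _ _ _ _ _ _ _ (DR s Hs') A1 (DR s Hs') A2) as T.
    refine (eq_trans (y := _ : R) _ (eq_sym T)); cbv beta.
    match goal with |- ?x = ?y => change (x = y :> R) end; ring.
  - apply (is_RInt_derive (fun s => phase eps (gam s)));
      rewrite Rmin_left, Rmax_right by lra; intros s Hs; destruct (D s Hs) as [D1 D2].
    + exact (is_derive_phase eps _ _ _ _ _ dd D1 D2).
    + destruct (Hg s Hs) as (_ & _ & C1 & C2).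
      assert (CR : continuous (fun u => r_ eps (gam u)) s).
      { apply (ex_derive_continuous (V := R_NormedModule)); eexists; apply DR, Hs. }
      apply (continuous_opp (V := R_NormedModule)).
      apply (continuous_mult (K := R_AbsRing)).
      * apply (continuous_mult (K := R_AbsRing)); [apply continuous_const|].
        simpl; apply (continuous_mult (K := R_AbsRing)); [exact CR|].
        apply (continuous_mult (K := R_AbsRing)); [exact CR | apply continuous_const].
      * apply (continuous_plus (V := R_NormedModule)); assumption.
Qed.

(** r^2 has mean value 1/3, so going once around the circle theta_1 + theta_2
    changes [phase] by exactly -2 pi, and the choice of the path is immaterial. *)
Lemma is_phase_unique eps t th :
  delta eps ^ 2 = 1 / 3 - eps ^ 2 / 2 -> is_phase eps t ->
  cong2pi (t th) (phase eps th).
Proof.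
  intros dd Ht; destruct (Ht th) as (gam & Hg & Hc).
  rewrite (integral_tau_f _ _ _ _ dd Hg) in Hc.
  destruct Hg as (G0 & G1 & _).
  apply (cong2pi_trans _ _ _ Hc).
  apply (phase_cong2pi eps) in G0, G1.
  pose proof (cong2pi_lin 1 (-1) _ _ _ _ G1 G0) as E.
  replace (phase eps (0, 0)) with 0 in E
    by (unfold phase; simpl; rewrite Rplus_0_r, sin_0, cos_0; ring).
  replace (phase eps th) with (1 * phase eps th + -1 * 0) by ring.
  replace (_ - _) with (1 * phase eps (gam 1) + -1 * phase eps (gam 0)) by ring.
  exact E.
Qed.

(** * The Legendrian isotopy *)

Definition sqradius1 (eps lam : R) (th : R * R) : R :=
  r_ eps th ^ 2 - lam * (2 / 3 * eps * cos (fst th)).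

Definition sqradius2 (eps lam : R) (th : R * R) : R :=
  r_ eps th ^ 2 + lam * (1 / 3 * eps * cos (fst th)).

Definition lift_phase (eps lam : R) (th : R * R) : R :=
  phase eps th + lam * s_ eps th.

(** The joint lift with parameter lam: the lift of f at lam = 0 and that of g at
    lam = 1, with the common phase absorbed into the three angles. *)
Definition lift_family (eps lam : R) (th : R * R) : C3 :=
  (polar (sqrt (sqradius1 eps lam th)) (2 * fst th + snd th + lift_phase eps lam th),
   polar (sqrt (sqradius2 eps lam th)) (fst th + 2 * snd th + lift_phase eps lam th),
   polar (sqrt (1 - sqradius1 eps lam th - sqradius2 eps lam th)) (lift_phase eps lam th)).

Definition inside_ball (eps lam : R) : Prop := forall th,
  0 < sqradius1 eps lam th /\ 0 < sqradius2 eps lam th /\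
  0 < 1 - sqradius1 eps lam th - sqradius2 eps lam th.

Lemma convex_pos a b lam :
  0 < a -> 0 < b -> 0 <= lam <= 1 -> 0 < (1 - lam) * a + lam * b.
Proof. intros; destruct (Rle_lt_dec a b); nra. Qed.

(** The squared radii are affine in lam, interpolating between those of f and g. *)
Lemma inside_ball_convex eps lam : 0 < eps -> eps < delta eps ->
  (forall th, 0 < radicand1 eps th) -> (forall th, 0 < radicand2 eps th) ->
  (forall th, in_B2 (f_ eps th)) -> (forall th, in_B2 (g_ eps th)) ->
  0 <= lam <= 1 -> inside_ball eps lam.
Proof.
  intros e0 L H1 H2 Hf Hg Hl th.
  specialize (H1 th); specialize (H2 th); specialize (Hf th); specialize (Hg th).
  unfold in_B2 in Hf, Hg; rewrite f_polar in Hf; rewrite g_polar in Hg.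
  simpl fst in *; simpl snd in *; rewrite !Cmod_polar in Hf, Hg.
  unfold r1_, r2_ in Hg; rewrite !pow2_sqrt in Hg by lra.
  pose proof (pow_lt _ 2 (r_pos _ th e0 L)) as Rp.
  unfold radicand1, radicand2, sqradius1, sqradius2 in *.
  set (q := r_ eps th ^ 2) in *; set (k := eps * cos (fst th)).
  replace (2 / 3 * eps * cos (fst th)) with (2 / 3 * k) in * by (unfold k; ring).
  replace (1 / 3 * eps * cos (fst th)) with (1 / 3 * k) in * by (unfold k; ring).
  pose proof (convex_pos q (q - 2 / 3 * k) lam).
  pose proof (convex_pos q (q + 1 / 3 * k) lam).
  pose proof (convex_pos (1 - 2 * q) (1 - 2 * q + 1 / 3 * k) lam).
  lra.
Qed.

Lemma sqradii_torus eps lam p q : teq p q ->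
  sqradius1 eps lam p = sqradius1 eps lam q /\ sqradius2 eps lam p = sqradius2 eps lam q.
Proof.
  intros H; destruct (teq_fst _ _ H) as [c _]; destruct (teq_sum_cos_sin _ _ H) as [_ s].
  unfold sqradius1, sqradius2, r_; now rewrite c, s.
Qed.

Lemma lift_phase_cong2pi eps lam p q : teq p q ->
  cong2pi (lift_phase eps lam p) (lift_phase eps lam q).
Proof.
  intros H; destruct (phase_cong2pi eps _ _ H) as [k Hk].
  destruct (teq_fst _ _ H) as [_ s].
  exists k; unfold lift_phase, s_; rewrite Hk, s; ring.
Qed.

Lemma lift_family_torus_map eps lam : torus_map (lift_family eps lam).
Proof.
  intros p q H; unfold lift_family.
  destruct (sqradii_torus eps lam _ _ H) as [-> ->].
  pose proof (lift_phase_cong2pi eps lam _ _ H).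
  f_equal; [f_equal|]; apply polar_cong2pi; auto;
    apply cong2pi_plus; auto using teq_arg1, teq_arg2.
Qed.

Lemma smooth_lift_phase {V : NormedModule R_AbsRing} eps (lam u v : V -> R) :
  smooth lam -> smooth u -> smooth v ->
  smooth (fun x => lift_phase eps (lam x) (u x, v x)).
Proof.
  intros Hl Hu Hv; unfold lift_phase, phase, s_; cbn; smooth_tac.
Qed.

Lemma smooth_sqradii {V : NormedModule R_AbsRing} eps (lam u v : V -> R) :
  smooth lam -> smooth u -> smooth v ->
  smooth (fun x => sqradius1 eps (lam x) (u x, v x)) /\
  smooth (fun x => sqradius2 eps (lam x) (u x, v x)).
Proof.
  intros Hl Hu Hv; unfold sqradius1, sqradius2, r_; simpl; split; smooth_tac.
Qed.

Lemma smooth_lift_family {V : NormedModule R_AbsRing} eps (lam u v : V -> R) :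
  smooth lam -> smooth u -> smooth v -> (forall x, inside_ball eps (lam x)) ->
  smoothC3 (fun x => lift_family eps (lam x) (u x, v x)).
Proof.
  intros Hl Hu Hv Hb.
  pose proof (smooth_lift_phase eps _ _ _ Hl Hu Hv) as Hp.
  destruct (smooth_sqradii eps _ _ _ Hl Hu Hv) as [H1 H2].
  unfold lift_family, z1, z2, z3; simpl fst; simpl snd.
  split; [|split]; unfold z1, z2, z3; simpl fst; simpl snd; apply smoothC_polar;
    try (apply smooth_sqrt; [intros x; apply (Hb x)|]); smooth_tac.
Qed.

Section LiftFamily.
Context (eps lam : R).
Context (dd : delta eps ^ 2 = 1 / 3 - eps ^ 2 / 2) (Hb : inside_ball eps lam).

Lemma is_derive_lift_phase (th v : R * R) :
  is_derive (fun s : R => lift_phase eps lam (plus th (scal s v))) 0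
    (- (3 * r_ eps th ^ 2 * (fst v + snd v)) + lam * (eps * cos (fst th) * fst v)).
Proof.
  pose proof (is_derive_phase eps _ _ _ _ _ dd
    (is_derive_line_fst th v) (is_derive_line_snd th v)) as P.
  assert (E : plus th (scal (0 : R) v) = th) by exact (line_at_0 th v).
  cbv beta in P; rewrite E in P.
  apply (is_derive_plus (V := R_NormedModule)); [destruct th; exact P|].
  apply is_derive_scal.
  apply (is_derive_ext (fun s => eps * sin (fst th + s * fst v))); [reflexivity|].
  auto_derive; [easy | rewrite Rmult_0_l, Rplus_0_r; ring].
Qed.

(** The velocities of the three angles of the lift, weighted by the squared radii.
    They vanish together only on the zero vector, whence the immersion, and their
    sum vanishes identically, whence the contact condition. *)
Lemma xdy_ydx_lift_family (th v : R * R) (w : C3) :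
  dirder3 (lift_family eps lam) th v w ->
  let z := lift_family eps lam th in
  let b := - (3 * r_ eps th ^ 2 * (fst v + snd v)) + lam * (eps * cos (fst th) * fst v) in
  let q1 := sqradius1 eps lam th in
  let q2 := sqradius2 eps lam th in
  xdy_ydx (z1 z) (z1 w) = q1 * (2 * fst v + snd v + b) /\
  xdy_ydx (z2 z) (z2 w) = q2 * (fst v + 2 * snd v + b) /\
  xdy_ydx (z3 z) (z3 w) = (1 - q1 - q2) * b.
Proof.
  intros (H1 & H2 & H3) z b q1 q2.
  pose proof (is_derive_lift_phase th v) as DB; fold b in DB.
  pose proof (is_derive_line_fst th v) as Du.
  pose proof (is_derive_line_snd th v) as Dv.
  assert (S : smooth (sqradius1 eps lam) /\ smooth (sqradius2 eps lam)).
  { exact (smooth_sqradii eps _ _ _ (smooth_const lam) smooth_fst_RR smooth_snd_RR). }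
  destruct S as [S1 S2]; destruct (Hb th) as (P1 & P2 & P3).
  split; [|split].
  - rewrite <- (pow2_sqrt q1) by (unfold q1; lra).
    refine (xdy_ydx_dirder_polar _ _ th v (z1 w) _ _ _ H1).
    + apply smooth_sqrt; [apply Hb | exact S1].
    + apply (is_derive_plus (V := R_NormedModule)); [|exact DB].
      apply (is_derive_plus (V := R_NormedModule)); [now apply is_derive_scal | easy].
  - rewrite <- (pow2_sqrt q2) by (unfold q2; lra).
    refine (xdy_ydx_dirder_polar _ _ th v (z2 w) _ _ _ H2).
    + apply smooth_sqrt; [apply Hb | exact S2].
    + apply (is_derive_plus (V := R_NormedModule)); [|exact DB].
      apply (is_derive_plus (V := R_NormedModule)); [easy | now apply is_derive_scal].
  - rewrite <- (pow2_sqrt (1 - q1 - q2)) by (unfold q1, q2; lra).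
    refine (xdy_ydx_dirder_polar _ _ th v (z3 w) _ _ _ H3).
    + apply smooth_sqrt; [apply Hb |].
      apply smooth_minus; [apply smooth_minus; [apply smooth_const|] |]; assumption.
    + exact DB.
Qed.

Lemma lift_family_immersion (th v : R * R) :
  dirder3 (lift_family eps lam) th v (RtoC 0, RtoC 0, RtoC 0) -> v = (0, 0).
Proof.
  intros H; pose proof (xdy_ydx_lift_family _ _ _ H) as X; cbv zeta in X.
  assert (Z : forall z, xdy_ydx z (RtoC 0) = 0)
    by (intros z; unfold xdy_ydx; simpl; ring).
  unfold z1 at 2, z2 at 2, z3 at 2 in X; simpl in X; rewrite !Z in X.
  destruct X as (X1 & X2 & X3); destruct (Hb th) as (P1 & P2 & P3).
  symmetry in X1, X2, X3; apply Rmult_integral in X1, X2, X3.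
  destruct v as [a b]; simpl in *; f_equal; lra.
Qed.

(** The terms in lam contribute - lam eps cos(theta_1) d theta_1 to the weighted
    sum of the two angle forms, which d (lam s_eps) compensates. *)
Lemma lift_family_contact (th v : R * R) (w : C3) :
  dirder3 (lift_family eps lam) th v w -> contact_form (lift_family eps lam th) w = 0.
Proof.
  intros H; destruct (xdy_ydx_lift_family _ _ _ H) as (X1 & X2 & X3).
  unfold contact_form; rewrite X1, X2, X3; unfold sqradius1, sqradius2; field.
Qed.

Lemma lift_family_S5 th : in_S5 (lift_family eps lam th).
Proof.
  destruct (Hb th) as (P1 & P2 & P3).
  unfold in_S5, lift_family, z1, z2, z3; simpl fst; simpl snd.
  rewrite !Cmod_polar, !pow2_sqrt by lra; ring.
Qed.

(** Two points of the lift over the same point of the ball are related by a deck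
    transformation of [covering_fibre], which moves theta_1 + theta_2 by a
    multiple of 4 pi / 3 up to multiples of 2 pi. The rest of the phase oscillates by
    less than 2, hence by less than 2 pi / 3, so equal phases force that multiple to
    be trivial. *)
Lemma lift_family_injective p q :
  0 < eps -> 12 * delta eps * eps < 1 - 3 * eps ^ 2 -> eps < 1 / 2 ->
  0 <= delta eps -> 0 <= lam <= 1 ->
  lift_family eps lam p = lift_family eps lam q -> teq p q.
Proof.
  intros e0 B e1 d0 Hl E.
  destruct (Hb p) as (P1 & P2 & P3); destruct (Hb q) as (Q1 & Q2 & Q3).
  pose proof (f_equal z1 E) as E1; pose proof (f_equal z2 E) as E2.
  pose proof (f_equal z3 E) as E3.
  unfold lift_family, z1, z2, z3 in E1, E2, E3.
  cbn [fst snd] in E1, E2, E3; clear E.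
  apply polar_inj in E1; [|apply sqrt_lt_R0; lra ..].
  apply polar_inj in E2; [|apply sqrt_lt_R0; lra ..].
  apply polar_inj in E3; [|apply sqrt_lt_R0; lra ..].
  destruct E1 as [_ A1]; destruct E2 as [_ A2]; destruct E3 as [_ A3].
  apply (fun H => cong2pi_plus_cancel _ _ _ _ H A3) in A1.
  apply (fun H => cong2pi_plus_cancel _ _ _ _ H A3) in A2.
  destruct (covering_fibre _ _ A1 A2) as (N & c & Hu & Hv).
  destruct A3 as [k Hk].
  unfold lift_phase, phase, s_ in Hk; cbv zeta in Hk.
  set (phi := fst p + snd p) in *; set (psi := fst q + snd q) in *.
  assert (Hphi : phi = psi + 4 * PI / 3 * IZR N + 2 * PI * IZR c)
    by (unfold phi, psi; lra).
  (* the multiple of 2 pi / 3 by which the phases differ, up to oscillation *)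
  set (W := IZR (2 * N + 3 * c + 3 * k)).
  assert (HW : 2 * PI / 3 * W =
     6 * delta eps * eps * (cos phi - cos psi)
     + 3 / 2 * eps ^ 2 * (sin phi * cos phi - sin psi * cos psi)
     + lam * eps * (sin (fst p) - sin (fst q))).
  { unfold W; rewrite !plus_IZR, !mult_IZR; lra. }
  assert (half : forall x y, Rabs (sin x * cos x - sin y * cos y) <= 1).
  { intros x y; apply Rabs_le.
    pose proof (SIN_bound (2 * x)); pose proof (SIN_bound (2 * y)).
    rewrite !sin_2a in *; lra. }
  (* the total is below 1 - 3/2 eps^2 + 2 eps, by the bound on delta eps *)
  assert (HB : Rabs (2 * PI / 3 * W) < 2).
  { rewrite HW; pose proof (half phi psi) as B1.
    apply Rabs_le_between in B1.
    pose proof (COS_bound phi); pose proof (COS_bound psi).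
    pose proof (SIN_bound (fst p)); pose proof (SIN_bound (fst q)).
    assert (0 <= delta eps * eps) by nra.
    assert (0 <= lam * eps <= eps) by nra.
    assert (T1 : - (12 * delta eps * eps) <= 6 * delta eps * eps * (cos phi - cos psi)
                 <= 12 * delta eps * eps) by (split; nra).
    assert (T2 : - (3 / 2 * eps ^ 2) <=
       3 / 2 * eps ^ 2 * (sin phi * cos phi - sin psi * cos psi) <= 3 / 2 * eps ^ 2)
      by (split; nra).
    assert (T3 : - (2 * eps) <= lam * eps * (sin (fst p) - sin (fst q)) <= 2 * eps)
      by (split; nra).
    apply Rabs_def1; nra. }
  assert (W0 : (2 * N + 3 * c + 3 * k = 0)%Z).
  { apply Rabs_def2 in HB; pose proof PI2_3_2.
    assert (-1 < W < 1) by (split; nra).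
    cut (-1 < 2 * N + 3 * c + 3 * k < 1)%Z; [lia|].
    split; apply lt_IZR; apply H0. }
  assert (E : (N = 3 * (N + c + k))%Z) by lia.
  apply (f_equal IZR) in E; rewrite mult_IZR in E.
  split; [exists (N + c + k)%Z | exists (N + c + k + c)%Z; rewrite plus_IZR]; nra.
Qed.

End LiftFamily.

Lemma lift_family_legendrian eps lam :
  0 < eps < 1 / 2 -> 0 <= delta eps -> delta eps ^ 2 = 1 / 3 - eps ^ 2 / 2 ->
  12 * delta eps * eps < 1 - 3 * eps ^ 2 -> 0 <= lam <= 1 -> inside_ball eps lam ->
  legendrian_embedding (lift_family eps lam).
Proof.
  intros [e0 e1] d0 dd B Hl Hb; split; [|split; [|split; [|split; [|split]]]].
  - apply lift_family_torus_map.
  - now apply lift_family_S5.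
  - exact (smooth_lift_family eps _ _ _ (smooth_const lam) smooth_fst_RR smooth_snd_RR
      (fun _ => Hb)).
  - intros p q; now apply lift_family_injective.
  - now apply lift_family_immersion.
  - now apply lift_family_contact.
Qed.

Lemma lift_family_0 eps t th :
  (forall x, 0 < r_ eps x) -> cong2pi (t th) (phase eps th) ->
  lift_family eps 0 th = f_lift eps t th.
Proof.
  intros Hr Ht; specialize (Hr th).
  assert (R1 : sqradius1 eps 0 th = r_ eps th ^ 2) by (unfold sqradius1; ring).
  assert (R2 : sqradius2 eps 0 th = r_ eps th ^ 2) by (unfold sqradius2; ring).
  assert (P : lift_phase eps 0 th = phase eps th) by (unfold lift_phase; ring).
  unfold lift_family, f_lift, Cscal3, z1, z2, z3; rewrite f_polar; cbn [fst snd].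
  rewrite R1, R2, P, sqrt_pow2, (cis_cong2pi _ _ Ht), !cis_polar by lra.
  replace (1 - 2 * r_ eps th ^ 2) with (1 - r_ eps th ^ 2 - r_ eps th ^ 2) by ring.
  f_equal; apply Cmult_comm.
Qed.

Lemma lift_family_1 eps t th :
  0 < radicand1 eps th -> 0 < radicand2 eps th -> cong2pi (t th) (phase eps th) ->
  lift_family eps 1 th = g_lift eps t th.
Proof.
  intros H1 H2 Ht.
  assert (R1 : sqradius1 eps 1 th = radicand1 eps th)
    by (unfold sqradius1, radicand1; ring).
  assert (R2 : sqradius2 eps 1 th = radicand2 eps th)
    by (unfold sqradius2, radicand2; ring).
  assert (P : cong2pi (t th + s_ eps th) (lift_phase eps 1 th)).
  { unfold lift_phase; apply cong2pi_plus; [exact Ht|].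
    rewrite Rmult_1_l; apply cong2pi_refl. }
  unfold lift_family, g_lift, Cscal3, z1, z2, z3; rewrite g_polar; cbn [fst snd].
  rewrite (cis_cong2pi _ _ P), !cis_polar, R1, R2.
  unfold r1_, r2_; rewrite !pow2_sqrt by lra.
  f_equal; apply Cmult_comm.
Qed.

(** Convexity keeps the radii positive for lam in [0, 1], whereas the isotopy has to
    be smooth for all real sigma; lam = sin^2 (pi sigma / 2) is smooth, stays in
    [0, 1], and runs from 0 to 1. *)
Lemma f_g_legendrian_isotopic eps t :
  0 < eps < 1 / 2 -> eps < delta eps -> delta eps ^ 2 = 1 / 3 - eps ^ 2 / 2 ->
  (forall th, 0 < radicand1 eps th) -> (forall th, 0 < radicand2 eps th) ->
  (forall th, in_B2 (f_ eps th)) -> (forall th, in_B2 (g_ eps th)) ->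
  is_phase eps t -> legendrian_isotopic (f_lift eps t) (g_lift eps t).
Proof.
  intros [e0 e1] L dd H1 H2 Hf Hg Ht.
  assert (B := eps_delta_bound eps dd Hf).
  set (cut := fun sig : R => sin (PI / 2 * sig) * sin (PI / 2 * sig)).
  assert (Hcut : forall sig, 0 <= cut sig <= 1).
  { intros sig; unfold cut; pose proof (SIN_bound (PI / 2 * sig)); nra. }
  exists (fun x => lift_family eps (cut (fst x)) (snd x)); split; [|split; [|split]].
  - assert (S : smooth (fun x : R * (R * R) => fst x) /\
      smooth (fun x : R * (R * R) => fst (snd x)) /\
      smooth (fun x : R * (R * R) => snd (snd x))).
    { pose (RR := prod_UniformSpace R_UniformSpace R_UniformSpace).
      split; [|split]; apply smooth_linear; try reflexivity; intros x.
      - apply (@continuous_fst R_UniformSpace RR).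
      - apply (continuous_comp (U := prod_UniformSpace R_UniformSpace RR) (V := RR) snd fst);
          [apply (@continuous_snd R_UniformSpace RR) | apply continuous_fst].
      - apply (continuous_comp (U := prod_UniformSpace R_UniformSpace RR) (V := RR) snd snd);
          [apply (@continuous_snd R_UniformSpace RR) | apply continuous_snd]. }
    destruct S as (S1 & S2 & S3).
    assert (Sc : smooth (fun x : R * (R * R) => cut (fst x)))
      by (unfold cut; smooth_tac).
    refine (smooth_lift_family eps _ _ _ Sc S2 S3 _).
    intros x; now apply inside_ball_convex.
  - intros sig _; cbn [fst snd].
    apply lift_family_legendrian; auto; [lra|].
    now apply inside_ball_convex.
  - intros p; cbn [fst snd].
    replace (cut 0) with 0 by (unfold cut; rewrite Rmult_0_r, sin_0; ring).
    apply lift_family_0; [intros; now apply r_pos | now apply is_phase_unique].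
  - intros p; cbn [fst snd].
    replace (cut 1) with 1 by (unfold cut; rewrite Rmult_1_r, sin_PI2; ring).
    apply lift_family_1; auto using is_phase_unique.
Qed.

(** * The double points *)

Lemma radicand_perturbation eps th :
  radicand2 eps th - radicand1 eps th = eps * cos (fst th) /\
  radicand1 eps th + 2 * radicand2 eps th = 3 * r_ eps th ^ 2.
Proof. unfold radicand1, radicand2; split; field. Qed.

Section DoublePoints.
Context (eps : R) (e0 : 0 < eps) (rpos : forall th, 0 < r_ eps th)
  (rad1 : forall th, 0 < radicand1 eps th) (rad2 : forall th, 0 < radicand2 eps th).

(** The two squared radii determine eps cos theta_1 and r^2, hence, as r and eps are
    positive, cos theta_1 and sin (theta_1 + theta_2). *)
Lemma g_eq_iff p q : g_ eps p = g_ eps q <->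
  (cos (fst p) = cos (fst q) /\ sin (fst p + snd p) = sin (fst q + snd q)) /\
  cong2pi (2 * fst p + snd p) (2 * fst q + snd q) /\
  cong2pi (fst p + 2 * snd p) (fst q + 2 * snd q).
Proof.
  rewrite !g_polar; split.
  - intros E.
    pose proof (f_equal fst E) as E1; pose proof (f_equal snd E) as E2.
    cbn [fst snd] in E1, E2; unfold r1_, r2_ in E1, E2.
    apply polar_inj in E1; [|now apply sqrt_lt_R0 ..].
    apply polar_inj in E2; [|now apply sqrt_lt_R0 ..].
    destruct E1 as [E1 A1], E2 as [E2 A2]; split; [|now split].
    apply sqrt_inj in E1; [|now apply Rlt_le ..].
    apply sqrt_inj in E2; [|now apply Rlt_le ..].
    destruct (radicand_perturbation eps p) as [Dp Sp].
    destruct (radicand_perturbation eps q) as [Dq Sq].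
    split; [apply Rmult_eq_reg_l with eps; lra|].
    assert (Er : r_ eps p = r_ eps q).
    { pose proof (rpos p); pose proof (rpos q); nra. }
    unfold r_ in Er; apply Rmult_eq_reg_l with eps; lra.
  - intros ((ec & es) & A1 & A2).
    assert (E1 : r1_ eps p = r1_ eps q)
      by (unfold r1_, radicand1, r_; now rewrite ec, es).
    assert (E2 : r2_ eps p = r2_ eps q)
      by (unfold r2_, radicand2, r_; now rewrite ec, es).
    rewrite E1, E2; f_equal; now apply polar_cong2pi.
Qed.

(** The solutions of the equations of [g_eq_iff], with second point obtained from
    the first by the translation by (2 pi / 3, 2 pi / 3); modulo 2 pi only the
    parities of i and j matter. *)
Definition crossing (i j : Z) : (R * R) * (R * R) :=
  ((- PI / 3 + PI * IZR i, PI / 6 + PI * IZR j),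
   (PI / 3 + PI * IZR i, 5 * PI / 6 + PI * IZR j)).

Lemma PI_IZR_eq_0 z : PI * IZR z = 0 -> z = 0%Z.
Proof.
  intros H; apply eq_IZR; pose proof PI_RGT_0.
  apply Rmult_eq_reg_l with PI; lra.
Qed.

Lemma crossing_double_point i j : double_point (g_ eps) (crossing i j).
Proof.
  unfold double_point, crossing; cbn [fst snd]; split.
  - intros [[k Hk] _]; cbn [fst snd] in Hk.
    assert (Z0 : (3 * k + 1 = 0)%Z); [|lia].
    apply PI_IZR_eq_0; rewrite plus_IZR, mult_IZR; lra.
  - apply g_eq_iff; cbn [fst snd]; split; [split|split].
    + rewrite <- (cos_neg (PI / 3 + PI * IZR i)).
      apply (cong2pi_cos_sin (- PI / 3 + PI * IZR i) (- (PI / 3 + PI * IZR i))).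
      exists i; field.
    + rewrite <- (sin_PI_x (PI / 3 + PI * IZR i + _)).
      apply cong2pi_cos_sin; exists (i + j)%Z; rewrite plus_IZR; field.
    + exists (-1)%Z; field.
    + exists (-1)%Z; field.
Qed.

Lemma crossing_same_pair i j i' j' : same_pair (crossing i j) (crossing i' j') ->
  exists k l : Z, (i = i' + 2 * k /\ j = j' + 2 * l)%Z.
Proof.
  intros [[[[k Hk] [l Hl]] _] | [[[k Hk] _] _]]; cbn [fst snd crossing] in *.
  - exists k, l; split; apply Zminus_eq; apply PI_IZR_eq_0;
      rewrite minus_IZR, plus_IZR, mult_IZR; lra.
  - exfalso; assert (Z0 : (3 * (i - i' - 2 * k) - 2 = 0)%Z); [|lia].
    apply PI_IZR_eq_0; rewrite !minus_IZR, mult_IZR, !minus_IZR, mult_IZR; lra.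
Qed.

Lemma crossing_mod_2 i j :
  teq (fst (crossing i j)) (fst (crossing (i mod 2) (j mod 2))) /\
  teq (snd (crossing i j)) (snd (crossing (i mod 2) (j mod 2))).
Proof.
  assert (M : forall m, IZR m = 2 * IZR (m / 2) + IZR (m mod 2)).
  { intros m; rewrite <- mult_IZR, <- plus_IZR; f_equal; apply Z.div_mod; lia. }
  pose proof (M i) as Mi; pose proof (M j) as Mj.
  unfold crossing; split; split; cbn [fst snd];
    [exists (i / 2)%Z | exists (j / 2)%Z | exists (i / 2)%Z | exists (j / 2)%Z];
    rewrite ?Mi, ?Mj; ring.
Qed.

(** Up to multiples of 2 pi, q is p translated by (2 pi / 3, 2 pi / 3). Equality of
    the cosines of theta_1 and theta_1 + 2 pi / 3 determines theta_1 modulo pi;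
    equality of the sines of phi = theta_1 + theta_2 and phi + 4 pi / 3 determines
    phi modulo pi. *)
Lemma crossing_of_deck p q d c :
  cos (fst p) = cos (fst q) -> sin (fst p + snd p) = sin (fst q + snd q) ->
  fst p = fst q + 2 * PI / 3 * IZR (3 * d - 1) ->
  snd p = snd q + 2 * PI / 3 * IZR (3 * d - 1) + 2 * PI * IZR c ->
  exists i j, teq p (fst (crossing i j)) /\ teq q (snd (crossing i j)).
Proof.
  intros ec es Hu Hv; rewrite minus_IZR, mult_IZR in Hu, Hv.
  pose proof PI_RGT_0 as pi0.
  assert (U : sin (fst p + PI / 3) = 0).
  { assert (S3 : 0 < sin (PI / 3)) by (apply sin_gt_0; lra).
    assert (E1 : cos (fst q) = cos (fst p + PI / 3 + PI / 3)).
    { apply cong2pi_cos_sin; exists (- d)%Z; rewrite opp_IZR; lra. }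
    assert (E2 : cos (fst p) = cos (fst p + PI / 3 - PI / 3)) by (f_equal; ring).
    rewrite cos_plus in E1; rewrite cos_minus in E2.
    apply Rmult_eq_reg_r with (2 * sin (PI / 3)); lra. }
  assert (W : cos (fst p + snd p + 2 * PI / 3) = 0).
  { assert (S3 : 0 < sin (2 * PI / 3)) by (apply sin_gt_0; lra).
    assert (E1 : sin (fst q + snd q) = sin (fst p + snd p + 2 * PI / 3 + 2 * PI / 3)).
    { apply cong2pi_cos_sin; exists (- 2 * d - c)%Z.
      rewrite minus_IZR, mult_IZR; lra. }
    assert (E2 : sin (fst p + snd p) = sin (fst p + snd p + 2 * PI / 3 - 2 * PI / 3))
      by (f_equal; ring).
    rewrite (sin_plus (fst p + snd p + _)) in E1; rewrite sin_minus in E2.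
    apply Rmult_eq_reg_r with (2 * sin (2 * PI / 3)); lra. }
  destruct (sin_eq_0_0 _ U) as [i Hi]; destruct (cos_eq_0_0 _ W) as [k Hk].
  exists i, (k - i)%Z; unfold crossing; split; split; cbn [fst snd];
    [exists 0%Z | exists 0%Z | exists (- d)%Z | exists (- d - c)%Z];
    rewrite ?minus_IZR, ?opp_IZR; lra.
Qed.

(** The points over a given pair of angles are the orbit of a translation of order
    three, so two distinct ones, in one of the two orders, differ by that
    translation itself. *)
Lemma double_point_crossing a : double_point (g_ eps) a ->
  exists i j, same_pair a (crossing (i mod 2) (j mod 2)).
Proof.
  destruct a as [p q]; intros [Hn Hg]; cbn [fst snd] in *.
  apply g_eq_iff in Hg; destruct Hg as ((ec & es) & A1 & A2).
  destruct (covering_fibre _ _ A1 A2) as (N & c & Hu & Hv).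
  assert (HN : (exists d, N = 3 * d \/ N = 3 * d - 1 \/ N = - (3 * - d - 1))%Z).
  { exists ((N + 1) / 3)%Z; pose proof (Z.div_mod (N + 1) 3).
    pose proof (Z.mod_pos_bound (N + 1) 3); lia. }
  destruct HN as [d [-> | [-> | ->]]].
  - exfalso; apply Hn; rewrite mult_IZR in Hu, Hv; split;
      [exists d | exists (d + c)%Z; rewrite plus_IZR]; lra.
  - destruct (crossing_of_deck p q d c) as (i & j & Hp & Hq); auto.
    destruct (crossing_mod_2 i j) as [M1 M2].
    exists i, j; left; split; eapply teq_trans; eauto.
  - destruct (crossing_of_deck q p (- d) (- c)%Z) as (i & j & Hp & Hq); auto;
      try (rewrite ?(opp_IZR c); rewrite opp_IZR in Hu, Hv; lra).
    destruct (crossing_mod_2 i j) as [M1 M2].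
    exists i, j; right; split; eapply teq_trans; eauto.
Qed.

(** * Transversality *)

(** The derivative at p along v of the square root of r^2 - k eps cos theta_1, with
    k = 2/3 for the first radius and k = - 1/3 for the second. *)
Definition radius_velocity (k : R) (radicand : (R * R) -> R) (p v : R * R) : R :=
  (2 * r_ eps p * eps * cos (fst p + snd p) * (fst v + snd v)
   + k * eps * sin (fst p) * fst v) / (2 * sqrt (radicand p)).

Lemma is_derive_radius k (radicand : R * R -> R) (p v : R * R) :
  (forall th, radicand th = r_ eps th ^ 2 - k * eps * cos (fst th)) ->
  (forall th, 0 < radicand th) ->
  is_derive (fun s : R => sqrt (radicand (plus p (scal s v)))) 0
    (radius_velocity k radicand p v).
Proof.
  intros Hr H0; unfold radius_velocity.
  assert (D : is_derive (fun s : R => radicand (plus p (scal s v))) 0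
    (2 * r_ eps p * eps * cos (fst p + snd p) * (fst v + snd v)
     + k * eps * sin (fst p) * fst v)).
  { apply (is_derive_ext (fun s => (delta eps + eps * sin (fst p + s * fst v
        + (snd p + s * snd v))) ^ 2 - k * eps * cos (fst p + s * fst v)));
      [intros s; now rewrite Hr|].
    auto_derive; [easy|]; rewrite !Rmult_0_l, !Rplus_0_r; unfold r_.
    match goal with |- ?x = ?y => change (x = y :> R) end; ring. }
  pose proof (is_derive_line_comp sqrt _ _ _ _ (/ (2 * sqrt (radicand p))) D) as C.
  apply C; pose proof (sqrt_lt_R0 _ (H0 p)).
  auto_derive; [apply H0 | field; lra].
Qed.

Lemma tangent_g p v : tangent (g_ eps) p
  (polar_velocity (r1_ eps p) (2 * fst p + snd p)
     (radius_velocity (2 / 3) (radicand1 eps) p v) (2 * fst v + snd v),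
   polar_velocity (r2_ eps p) (fst p + 2 * snd p)
     (radius_velocity (- (1 / 3)) (radicand2 eps) p v) (fst v + 2 * snd v)).
Proof.
  exists v; split; cbn [fst snd].
  - apply (dirder_polar (r1_ eps) (fun p => 2 * fst p + snd p)).
    + apply is_derive_radius; [reflexivity | exact rad1].
    + apply (is_derive_plus (V := R_NormedModule));
        [apply is_derive_scal, is_derive_line_fst | apply is_derive_line_snd].
  - apply (dirder_polar (r2_ eps) (fun p => fst p + 2 * snd p)).
    + apply is_derive_radius; [|exact rad2].
      intros th; unfold radicand2; ring.
    + apply (is_derive_plus (V := R_NormedModule));
        [apply is_derive_line_fst | apply is_derive_scal, is_derive_line_snd].
Qed.

Lemma polar_velocity_plus rho a dr da dr' da' :
  Cplus (polar_velocity rho a dr da) (polar_velocity rho a dr' da') =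
  polar_velocity rho a (dr + dr') (da + da').
Proof. unfold polar_velocity, cis, Cmult, Cplus; cbn [fst snd]; f_equal; ring. Qed.

Lemma polar_velocity_cong2pi rho a b dr da : cong2pi a b ->
  polar_velocity rho a dr da = polar_velocity rho b dr da.
Proof. intros H; unfold polar_velocity; now rewrite (cis_cong2pi a b). Qed.

Lemma polar_velocity_surj rho a (w : C) : 0 < rho ->
  exists dr da, w = polar_velocity rho a dr da.
Proof.
  intros h; destruct w as [x y].
  exists (x * cos a + y * sin a), ((y * cos a - x * sin a) / rho).
  unfold polar_velocity, cis, Cmult; cbn [fst snd].
  pose proof (sin2_cos2 a) as SC; unfold Rsqr in SC.
  replace (rho * ((y * cos a - x * sin a) / rho)) with (y * cos a - x * sin a)
    by (field; lra).
  f_equal; [transitivity (x * 1) | transitivity (y * 1)]; try ring; rewrite <- SC; ring.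
Qed.

Lemma split_sum a b s y : a <> b -> exists x, a * x + b * (s - x) = y.
Proof. intros H; exists ((y - b * s) / (a - b)); field; lra. Qed.

(** Both tangent planes are graphs over the plane of the two angles, so they are
    transverse when the differentials at the two points of the squared radii, or
    equivalently of r^2 and eps cos theta_1, differ by an invertible map. In the
    coordinates theta_1 + theta_2 and theta_1 these differentials are diagonal,
    with entries proportional to cos (theta_1 + theta_2) and sin theta_1. As
    sin (theta_1 + theta_2) and cos theta_1 agree at the two points, agreement of
    either entry would make the points equal. *)
Lemma double_point_transverse a : double_point (g_ eps) a -> transverse_at (g_ eps) a.
Proof.
  destruct a as [p q]; intros [Hn Hg]; cbn [fst snd] in *.
  apply g_eq_iff in Hg; destruct Hg as ((ec & es) & A1 & A2).
  assert (Hs : sin (fst p) <> sin (fst q)).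
  { intros es'; apply Hn.
    assert (H : cong2pi (fst p) (fst q)) by (now apply cong2pi_cos_sin).
    split; [exact H|].
    pose proof (cong2pi_lin 1 (-2) _ _ _ _ A1 H) as K.
    replace (snd p) with (1 * (2 * fst p + snd p) + -2 * fst p) by ring.
    replace (snd q) with (1 * (2 * fst q + snd q) + -2 * fst q) by ring; exact K. }
  assert (Hc : cos (fst p + snd p) <> cos (fst q + snd q)).
  { intros ec'; apply Hn.
    assert (H : cong2pi (fst p + snd p) (fst q + snd q)) by (now apply cong2pi_cos_sin).
    pose proof (cong2pi_lin 1 (-1) _ _ _ _ A1 H) as K1.
    pose proof (cong2pi_lin 1 (-1) _ _ _ _ A2 H) as K2.
    split.
    - replace (fst p) with (1 * (2 * fst p + snd p) + -1 * (fst p + snd p)) by ring.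
      replace (fst q) with (1 * (2 * fst q + snd q) + -1 * (fst q + snd q)) by ring.
      exact K1.
    - replace (snd p) with (1 * (fst p + 2 * snd p) + -1 * (fst p + snd p)) by ring.
      replace (snd q) with (1 * (fst q + 2 * snd q) + -1 * (fst q + snd q)) by ring.
      exact K2. }
  intros [w1 w2].
  assert (Er : r_ eps p = r_ eps q) by (unfold r_; now rewrite es).
  assert (E1 : radicand1 eps p = radicand1 eps q)
    by (unfold radicand1; now rewrite Er, ec).
  assert (E2 : radicand2 eps p = radicand2 eps q)
    by (unfold radicand2; now rewrite Er, ec).
  pose proof (sqrt_lt_R0 _ (rad1 p)) as P1; pose proof (sqrt_lt_R0 _ (rad2 p)) as P2.
  pose proof (rpos p) as Rp.
  destruct (polar_velocity_surj (r1_ eps p) (2 * fst p + snd p) w1 P1)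
    as (dr1 & da1 & ->).
  destruct (polar_velocity_surj (r2_ eps p) (fst p + 2 * snd p) w2 P2)
    as (dr2 & da2 & ->).
  (* the sum (X, Y) of the two directions is forced by the angles; m and n are the
     required variations of r^2 and of - eps cos theta_1 *)
  set (X := (2 * da1 - da2) / 3); set (Y := (2 * da2 - da1) / 3).
  set (m := (2 * sqrt (radicand1 eps p) * dr1 + 4 * sqrt (radicand2 eps p) * dr2) / 3).
  set (n := 2 * sqrt (radicand1 eps p) * dr1 - 2 * sqrt (radicand2 eps p) * dr2).
  destruct (split_sum _ _ X (n / eps) Hs) as [x Hx].
  destruct (split_sum _ _ (X + Y) (m / (2 * r_ eps p * eps)) Hc) as [z Hz].
  pose proof (tangent_g q (X - x, Y - (z - x))) as Tq.
  assert (F1 : r1_ eps q = r1_ eps p) by (unfold r1_; now rewrite E1).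
  assert (F2 : r2_ eps q = r2_ eps p) by (unfold r2_; now rewrite E2).
  rewrite F1, F2, <- (polar_velocity_cong2pi _ _ _ _ _ A1),
    <- (polar_velocity_cong2pi _ _ _ _ _ A2) in Tq.
  eexists; eexists; split; [exact (tangent_g p (x, z - x))|].
  split; [exact Tq|].
  cbn [fst snd]; rewrite !polar_velocity_plus.
  assert (Hm : 2 * r_ eps p * eps * (cos (fst p + snd p) * z
     + cos (fst q + snd q) * (X + Y - z)) = m) by (rewrite Hz; field; lra).
  assert (Hn' : eps * (sin (fst p) * x + sin (fst q) * (X - x)) = n)
    by (rewrite Hx; field; lra).
  unfold radius_velocity; rewrite <- E1, <- E2, <- Er; cbn [fst snd].
  f_equal; f_equal.
  - apply Rmult_eq_reg_l with (2 * sqrt (radicand1 eps p)); [|lra].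
    transitivity (m + 2 / 3 * n); [unfold m, n; field|].
    rewrite <- Hm, <- Hn'; field; lra.
  - unfold X, Y; field.
  - apply Rmult_eq_reg_l with (2 * sqrt (radicand2 eps p)); [|lra].
    transitivity (m - 1 / 3 * n); [unfold m, n; field|].
    rewrite <- Hm, <- Hn'; field; lra.
  - unfold X, Y; field.
Qed.

Lemma g_four_transverse_double_points : has_exactly_transverse_double_points (g_ eps) 4.
Proof.
  split; [|exact double_point_transverse].
  exists (crossing 0 0 :: crossing 0 1 :: crossing 1 0 :: crossing 1 1 :: nil).
  split; [reflexivity|]; split; [|split].
  - intros a H; cbn in H; intuition subst; apply crossing_double_point.
  - repeat constructor; intros H; apply crossing_same_pair in H;
      destruct H as (k & l & H); lia.
  - intros a Ha; destruct (double_point_crossing _ Ha) as (i & j & H).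
    eexists; split; [|exact H].
    pose proof (Z.mod_pos_bound i 2); pose proof (Z.mod_pos_bound j 2).
    assert (Hi : (i mod 2 = 0 \/ i mod 2 = 1)%Z) by lia.
    assert (Hj : (j mod 2 = 0 \/ j mod 2 = 1)%Z) by lia.
    destruct Hi as [-> | ->], Hj as [-> | ->]; cbn; auto.
Qed.

End DoublePoints.

Theorem theorem4p13 (eps : R) (t : R * R -> R)
  (eps_pos : 0 < eps) (eps_lt : eps < sqrt (2 / 3))
  (rad1_pos : forall th, 0 < radicand1 eps th)
  (rad2_pos : forall th, 0 < radicand2 eps th)
  (f_in_B2 : forall th, in_B2 (f_ eps th))
  (g_in_B2 : forall th, in_B2 (g_ eps th))
  (t_phase : is_phase eps t) :
  is_perturbation (f_ eps) (r_ eps) (g_ eps) (r1_ eps) (r2_ eps) /\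
  has_exactly_transverse_double_points (g_ eps) 4 /\
  legendrian_isotopic (f_lift eps t) (g_lift eps t).
Proof.
  destruct (delta_sqr eps eps_pos eps_lt) as [d0 dd].
  pose proof (eps_lt_delta eps eps_pos d0 rad1_pos) as L.
  assert (e1 : eps < 1 / 2) by nra.
  split; [|split].
  - assert (T : forall p q, teq p q -> r_ eps p = r_ eps q).
    { intros p q H; unfold r_; now rewrite (proj2 (teq_sum_cos_sin _ _ H)). }
    split; [exact T|].
    split; [|split; [|split; reflexivity]]; intros p q H;
      unfold r1_, r2_, radicand1, radicand2;
      now rewrite (T _ _ H), (proj1 (teq_fst _ _ H)).
  - apply g_four_transverse_double_points; auto; intros th; now apply r_pos.
  - apply f_g_legendrian_isotopic; auto.
Qed.
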